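(* Let $\mathbf{v} = (v_n)_{n \geq 0}$ be the infinite word over the alphabet $\{0,1,2\}$ that is the fixed point, starting with $0$, of the morphism $0 \mapsto 012$, $1 \mapsto 02$, $2 \mapsto 1$ (so $\mathbf{v} = 012021012102012\cdots$). Then for each integer $k \geq 2$, the sequence $(v_{kn})_{n \geq 0}$ contains the square $00$ or the square $22$ as a factor, i.e., there exists $n \geq 0$ with $v_{kn} = v_{k(n+1)} = 0$ or $v_{kn} = v_{k(n+1)} = 2$.
   Context: A square is a nonempty word of the form $xx$. A factor of an infinite word is a finite block of consecutive letters. Indexing of $\mathbf{v}$ starts at $0$. *)

(* Defs.v *)
From mathcomp Require Import all_boot.
Set Implicit Arguments.
Unset Strict Implicit.
Unset Printing Implicit Defensive.

(* Infinite words over A are functions nat -> A, indexed from 0; the prefix of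
   length n of w is [mkseq w n]. *)

Definition morph (A B : Type) (f : A -> seq B) (s : seq A) : seq B :=
  flatten (map f s).

(* u = f(w) for infinite words: every f(prefix of w) is a prefix of u. This
   determines u when f is non-erasing, as [h] below is. *)
Definition morphic_image (A B : Type) (f : A -> seq B)
    (w : nat -> A) (u : nat -> B) : Prop :=
  forall n, mkseq u (size (morph f (mkseq w n))) = morph f (mkseq w n).

Definition fixed_point (A : Type) (f : A -> seq A) (w : nat -> A) : Prop :=
  morphic_image f w w.

Definition factor (A : Type) (s : seq A) (w : nat -> A) : Prop :=
  exists n, mkseq (fun i => w (n + i)) (size s) = s.

Definition l0 : 'I_3 := @Ordinal 3 0 isT.
Definition l1 : 'I_3 := @Ordinal 3 1 isT.
Definition l2 : 'I_3 := @Ordinal 3 2 isT.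

Definition h (a : 'I_3) : seq 'I_3 :=
  nth [::] [:: [:: l0; l1; l2]; [:: l0; l2]; [:: l1]] a.

Lemma h_nonerasing a : 0 < size (h a).
Proof. by case: a => [[|[|[|m]]] i]. Qed.

Lemma morph_cat (A B : Type) (f : A -> seq B) s t :
  morph f (s ++ t) = morph f s ++ morph f t.
Proof. by rewrite /morph map_cat flatten_cat. Qed.

Lemma size_morph_h s : size s <= size (morph h s).
Proof.
elim: s => //= a s IH; rewrite /morph /= size_cat -add1n.
by apply: leq_add; rewrite ?h_nonerasing.
Qed.

Lemma iter_morph_cat n s t :
  iter n (morph h) (s ++ t) = iter n (morph h) s ++ iter n (morph h) t.
Proof. by elim: n => //= n ->; rewrite morph_cat. Qed.

Lemma iter_morphS n : iter n.+1 (morph h) [:: l0] =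
  iter n (morph h) [:: l0] ++ iter n (morph h) [:: l1; l2].
Proof. by rewrite iterSr -iter_morph_cat. Qed.

Lemma size_iter_morph n s : size s <= size (iter n (morph h) s).
Proof. by elim: n => //= n /leq_trans; apply; apply: size_morph_h. Qed.

Lemma ltn_size_iter n : n < size (iter n (morph h) [:: l0]).
Proof.
elim: n => // n IH; rewrite iter_morphS size_cat -addn1.
by apply: (@leq_add n.+1 1) => //; apply: leq_trans (size_iter_morph n _).
Qed.

Lemma nth_iter_morph m n i : m <= n -> i < size (iter m (morph h) [:: l0]) ->
  nth l0 (iter n (morph h) [:: l0]) i = nth l0 (iter m (morph h) [:: l0]) i.
Proof.
move=> + ltim; elim: n => [|n IH]; first by rewrite leqn0 => /eqP ->.
rewrite leq_eqVlt => /orP[/eqP<- //|]; rewrite ltnS => lemn.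
rewrite iter_morphS nth_cat IH // ifT //; apply: leq_trans ltim _.
elim: n lemn {IH} => [|n IH]; first by rewrite leqn0 => /eqP ->.
rewrite leq_eqVlt => /orP[/eqP-> //|]; rewrite ltnS => /IH/leq_trans; apply.
by rewrite iter_morphS size_cat leq_addr.
Qed.

Lemma fixed_point_h_exists :
  exists v : nat -> 'I_3, v 0 = l0 /\ fixed_point h v.
Proof.
pose v n := nth l0 (iter n (morph h) [:: l0]) n.
have prefv N k : k <= size (iter N (morph h) [:: l0]) ->
  mkseq v k = take k (iter N (morph h) [:: l0]).
  move=> le_k; apply: (@eq_from_nth _ l0) => [|i].
    by rewrite size_mkseq size_takel.
  rewrite size_mkseq => lt_ik; rewrite nth_mkseq // nth_take // /v.
  have [leiN|/ltnW leNi] := leqP i N.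
    by rewrite (nth_iter_morph leiN) // ltn_size_iter.
  by rewrite -(nth_iter_morph leNi) // (leq_trans lt_ik).
exists v; split=> // n.
set W := iter n (morph h) [:: l0].
have defW1 : iter n.+1 (morph h) [:: l0]
  = morph h (mkseq v n) ++ morph h (drop n W).
  by rewrite (prefv n) ?(ltnW (ltn_size_iter n)) // -morph_cat cat_take_drop.
by rewrite (prefv n.+1) defW1 ?take_size_cat // size_cat leq_addr.
Qed.

Lemma fixed_point_h_unique (v w : nat -> 'I_3) :
  v 0 = l0 -> fixed_point h v -> w 0 = l0 -> fixed_point h w -> v =1 w.
Proof.
have step u n : u 0 = l0 -> n < size (morph h (mkseq u n.+1)).
  by move=> _; apply: leq_trans (size_morph_h _); rewrite size_mkseq.
move=> v0 fv w0 fw n.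
suff : mkseq v n.+1 = mkseq w n.+1.
  by move=> /(congr1 (fun s => nth l0 s n)); rewrite !nth_mkseq.
elim: n => [|n IH]; first by rewrite /mkseq /= v0 w0.
have e : morph h (mkseq v n.+1) = morph h (mkseq w n.+1) by rewrite IH.
have big : n.+2 <= size (morph h (mkseq v n.+1)).
  rewrite -add1n /mkseq -[n.+1]add1n iotaD map_cat morph_cat size_cat /= v0.
  apply: (@leq_add 2 n) => //; apply: leq_trans (size_morph_h _).
  by rewrite size_map size_iota.
have := fw n.+1; rewrite -e -{2}(fv n.+1) => /(congr1 (take n.+2)).
by rewrite /mkseq -!map_take !take_iota (minn_idPl big) => ->.
Qed.

(* Main.v *)
Require Import Defs.
From mathcomp Require Import all_boot.
From mathcomp Require Import cyclic zify.
From Stdlib Require Import Classical_Prop.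

(** Let t be the Thue-Morse word. Then v_n is 0, 2 or 1 according as
    (t_n, t_{n+1}) is (0,1), (1,0) or constant, so it suffices to find
    consecutive multiples m, m + k of k, both followed by a change of letter
    in t, with t_m = t_{m+k}. As t_k = t_{2k}, the pair k, 2k works unless
    t_k = t_{k+1}, which forces k = 1, 5 or 7 mod 8. If k = 5 mod 8, a pair
    k (2^j - 1), k 2^j with j of the right parity works. Otherwise, if no pair
    works, comparing a multiple of k that is 3 mod 8 with its two neighbours
    shows that, for all b,
    t_{k(4b+1)} = t_{k(2b+1)} if k = 1 mod 8, and
    t_{k(4b+3)} = t_{k(2b+1)} if k = 7 mod 8.
    Since k > 1 is odd, Euler's theorem gives a multiple of k close to a power
    of 2; it can be placed so that a carry occurs in one of the two indices and
    not in the other, which contradicts t_k = t_{k+1}. *)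

(** * The Thue-Morse word, as the parity of binary digit sums *)

Fixpoint thue_morse_rec (f n : nat) : bool :=
  if f is f'.+1 then odd n (+) thue_morse_rec f' n./2 else false.

(** Fuel [n] suffices, since [n] halvings bring [n] down to 0. *)
Definition thue_morse n := thue_morse_rec n n.

Lemma thue_morse_recE f n : n <= f -> thue_morse_rec f n = thue_morse n.
Proof.
have rec0 g : thue_morse_rec g 0 = false by elim: g.
have enough g1 g2 m : m <= g1 -> m <= g2 ->
    thue_morse_rec g1 m = thue_morse_rec g2 m.
  elim: g1 g2 m => [|g1 IH] [|g2] m m1 m2 //=.
  - by move: m1; rewrite leqn0 => /eqP ->; rewrite rec0.
  - by move: m2; rewrite leqn0 => /eqP ->; rewrite rec0.
  by congr (_ (+) _); apply: IH; lia.
by move=> le_nf; apply: enough.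
Qed.

Lemma thue_morse_half n : thue_morse n = odd n (+) thue_morse n./2.
Proof.
rewrite -(@thue_morse_recE n.+1 n) //= (@thue_morse_recE n) //; lia.
Qed.

Lemma thue_morse_double n : thue_morse n.*2 = thue_morse n.
Proof. by rewrite thue_morse_half odd_double doubleK. Qed.

Lemma thue_morse_doubleS n : thue_morse n.*2.+1 = ~~ thue_morse n.
Proof. by rewrite thue_morse_half /= odd_double uphalf_double. Qed.

(** In binary, [r] fills the low [j] places below [x], so the digit sums add. *)
Lemma thue_morse_expD j x r : r < 2 ^ j ->
  thue_morse (2 ^ j * x + r) = thue_morse x (+) thue_morse r.
Proof.
elim: j x r => [|j IH] x r.
  by rewrite expn0 ltnS leqn0 => /eqP ->; rewrite mul1n addn0 addbF.
rewrite expnS => lt_r.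
have ->: 2 * 2 ^ j * x + r = odd r + (2 ^ j * x + r./2).*2.
  have := odd_double_half r; lia.
have lt_r2 : r./2 < 2 ^ j by lia.
rewrite [in RHS](thue_morse_half r).
case: (odd r); rewrite /= ?add1n ?thue_morse_doubleS ?add0n ?thue_morse_double.
  by rewrite IH // addbN.
by rewrite IH.
Qed.

Lemma thue_morse_mulexp j x : thue_morse (2 ^ j * x) = thue_morse x.
Proof. by rewrite -[_ * x]addn0 thue_morse_expD ?expn_gt0 // addbF. Qed.

(** * The fixed point as a coding of the Thue-Morse word *)

Definition vtm n : 'I_3 :=
  if thue_morse n == thue_morse n.+1 then l1
  else if thue_morse n then l2 else l0.

(** The image of the letter at n has length 2 + t_{n+1} - t_n; these lengths telescope to 2n +
    t_n. *)
Lemma morph_h_vtm n :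
  morph h (mkseq vtm n) = mkseq vtm (n.*2 + thue_morse n).
Proof.
elim: n => // n IH.
rewrite mkseqS -cats1 morph_cat IH /morph /= cats0.
have e0 := thue_morse_double n; have e1 := thue_morse_doubleS n.
have e2 := thue_morse_double n.+1; have e3 := thue_morse_doubleS n.+1.
rewrite !doubleS in e2 e3.
rewrite /vtm; case E: (thue_morse n) e0 e1 => e0 e1;
  case E': (thue_morse n.+1) e2 e3 => e2 e3 /=;
  rewrite ?addn0 ?addn1 !mkseqS -!cats1 -?catA /= ?e0 ?e1 ?e2 ?e3 //=.
Qed.

Lemma fixed_point_vtm : fixed_point h vtm.
Proof. by move=> n; rewrite morph_h_vtm size_mkseq. Qed.

Definition letter_change m := thue_morse m != thue_morse m.+1.

Lemma letter_change_even m : ~~ odd m -> letter_change m.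
Proof.
move=> even_m; rewrite /letter_change.
have ->: m = m./2.*2 by lia.
by rewrite thue_morse_double thue_morse_doubleS; case: thue_morse.
Qed.

(** In binary, m ends in 011 and m + 1 in 100 after the same prefix. *)
Lemma letter_change_3mod8 m : m %% 8 = 3 -> letter_change m.
Proof.
move=> m3; rewrite /letter_change.
have ->: m = (m %/ 8).*2.*2.+1.*2.+1 by lia.
rewrite -doubleS thue_morse_double !(thue_morse_doubleS, thue_morse_double).
have ->: (m %/ 8).*2.*2.+2 = (m %/ 8).*2.+1.*2 by lia.
by rewrite thue_morse_double thue_morse_doubleS; case: thue_morse.
Qed.

(** The factor 2k in the exponent only serves to push the power above 2k. *)
Lemma expn2_1mod k : 1 < k -> odd k ->
  exists P d, 2 * k < 2 ^ P /\ 2 ^ P = k * d + 1.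
Proof.
move=> k_gt1 odd_k; have k_gt0 := ltnW k_gt1.
exists (totient k * (2 * k)), (2 ^ (totient k * (2 * k)) %/ k); split.
  apply: leq_trans (ltn_expl (2 * k) (isT : 1 < 2)) _.
  by rewrite leq_exp2l // leq_pmull ?totient_gt0.
rewrite {1}(divn_eq (2 ^ (totient k * (2 * k))) k) mulnC; congr (_ + _).
rewrite expnM -modnXm Euler_exp_totient ?coprime2n //.
by rewrite modnXm exp1n modn_small.
Qed.

(** * Residues of k mod 8 in the absence of squares *)

Section NoSquare.

Variable k : nat.
Hypothesis k_gt1 : 1 < k.
Hypothesis no_square : forall n,
  letter_change (k * n) -> letter_change (k * n.+1) ->
  thue_morse (k * n.+1) = ~~ thue_morse (k * n).

Let thue_morse_succ : thue_morse k.+1 = thue_morse k.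
Proof.
have [//|change_k] := eqVneq (thue_morse k) (thue_morse k.+1).
have := no_square 1; rewrite muln1 (mulnC k 2) mul2n thue_morse_double.
have -> : letter_change k.*2 by apply: letter_change_even; rewrite odd_double.
by move=> /(_ change_k isT); case: thue_morse.
Qed.

Let not_1mod8 : k %% 8 <> 1.
Proof.
move=> k1.
have eq_b b : thue_morse (k * (4 * b + 1)) = thue_morse (k * (2 * b + 1)).
  have c3 : letter_change (k * (8 * b + 2).+1).
    by apply: letter_change_3mod8; rewrite -modnMm k1; lia.
  have c2 : letter_change (k * (8 * b + 2)).
    by apply: letter_change_even; lia.
  have c4 : letter_change (k * (8 * b + 2).+2).
    by apply: letter_change_even; lia.
  move: (no_square _ c3 c4); rewrite (no_square _ c2 c3) negbK.
  have ->: k * (8 * b + 2).+2 = 2 ^ 2 * (k * (2 * b + 1)) by lia.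
  have ->: k * (8 * b + 2) = 2 ^ 1 * (k * (4 * b + 1)) by lia.
  by rewrite !thue_morse_mulexp.
have [P [d [ltP dE]]] : exists P d, 2 * k < 2 ^ P /\ 2 ^ P = k * d + 1.
  by apply: expn2_1mod; lia.
have [i i_le i_gt] : exists2 i, 2 * 2 ^ i <= k & k < 4 * 2 ^ i.
  have log_gt0 : 0 < trunc_log 2 k by rewrite trunc_log_gt0.
  have k_gt0 := ltnW k_gt1.
  have /andP[le_k gt_k] := trunc_log_bounds (isT : 1 < 2) k_gt0.
  exists (trunc_log 2 k).-1; first by rewrite -expnS prednK.
  by rewrite -(expnD 2 2) add2n prednK.
(* Take b = 2^(i+P) y + 2^i d. As k d = 2^P - 1, the two indices are 2^(i+P) (4ky + 4) - (4 * 2^i -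
   k) and 2^(i+P) (2ky + 2) + (k - 2 * 2^i). By the choice of i only the first borrows, leaving the
   remainders r and s. *)
pose s := k - 2 * 2 ^ i; pose r := 2 ^ (i + P) + 2 * s - k.
have iP : k < 2 ^ (i + P).
  have : 2 ^ P <= 2 ^ (i + P) by rewrite leq_exp2l // leq_addl.
  lia.
have key y : thue_morse (k * y).+1 (+) thue_morse s
    = thue_morse (k * y) (+) thue_morse r.
  have := eq_b (2 ^ (i + P) * y + 2 ^ i * d).
  have ->: k * (4 * (2 ^ (i + P) * y + 2 ^ i * d) + 1)
      = 2 ^ (i + P) * (k * y).*2.+1.*2.+1 + r.
    by rewrite /r /s; move: iP; rewrite expnD dE; lia.
  have ->: k * (2 * (2 ^ (i + P) * y + 2 ^ i * d) + 1)
      = 2 ^ (i + P) * (k * y).+1.*2 + s.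
    by rewrite /s; move: iP; rewrite expnD dE; lia.
  rewrite !thue_morse_expD; [|rewrite /s; lia|rewrite /r /s; lia].
  by rewrite thue_morse_double !thue_morse_doubleS negbK => ->.
(* At y = 0 the identity makes t_r and t_s differ; at y = 1, as t_{k+1} = t_k, it makes them
   equal. *)
move: (key 0) (key 1); rewrite muln0 muln1 thue_morse_succ.
by case: (thue_morse k) (thue_morse s) (thue_morse r) => [] [] [].
Qed.

Let not_7mod8 : k %% 8 <> 7.
Proof.
move=> k7.
have eq_b b : thue_morse (k * (2 * b + 1)) = thue_morse (k * (4 * b + 3)).
  have c5 : letter_change (k * (8 * b + 4).+1).
    by apply: letter_change_3mod8; rewrite -modnMm k7; lia.
  have c4 : letter_change (k * (8 * b + 4)).
    by apply: letter_change_even; lia.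
  have c6 : letter_change (k * (8 * b + 4).+2).
    by apply: letter_change_even; lia.
  move: (no_square _ c5 c6); rewrite (no_square _ c4 c5) negbK.
  have ->: k * (8 * b + 4) = 2 ^ 2 * (k * (2 * b + 1)) by lia.
  have ->: k * (8 * b + 4).+2 = 2 ^ 1 * (k * (4 * b + 3)) by lia.
  by rewrite !thue_morse_mulexp.
have [P [d [ltP dE]]] : exists P d, 2 * k < 2 ^ P /\ 2 ^ P = k * d + 1.
  by apply: expn2_1mod; lia.
case: P ltP dE => [|j]; first by rewrite expn0; lia.
rewrite expnS => ltj dE.
have odd_d : odd d.
  have : odd (k * d) by lia.
  by rewrite oddM => /andP[].
pose c := d./2; have cE : d = 2 * c + 1 by rewrite /c; lia.
rewrite cE in dE.
have j_le : k - 2 < 2 ^ j by lia.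
(* Here b = 2^j y + c and k (2c + 1) = 2^(j+1) - 1, so k (4c + 3) = 2^(j+2) + (k - 2): only the
   second index carries into ky. *)
have key y : ~~ thue_morse (k * y) (+) thue_morse (2 ^ j).-1
    = thue_morse (k * y).+1 (+) thue_morse (k - 2).
  have := eq_b (2 ^ j * y + c).
  have ->: k * (2 * (2 ^ j * y + c) + 1)
      = 2 ^ j * (k * y).*2.+1 + (2 ^ j).-1 by lia.
  have ->: k * (4 * (2 ^ j * y + c) + 3)
      = 2 ^ j * (k * y).+1.*2.*2 + (k - 2) by lia.
  rewrite !thue_morse_expD //; last by lia.
  by rewrite !thue_morse_double thue_morse_doubleS.
move: (key 0) (key 1); rewrite muln0 muln1 thue_morse_succ.
by case: (thue_morse k) (thue_morse _.-1) (thue_morse (k - 2)) => [] [] [].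
Qed.

(* Neighbouring multiples k (2^J - 1) and k 2^J: the letter at the latter does
   not depend on J, while the letter at the former alternates. *)
Let not_5mod8 : k %% 8 <> 5.
Proof.
move=> k5.
have key j : k <= 2 ^ (j + 3) ->
    thue_morse k = ~~ (thue_morse k.-1 (+) thue_morse (2 ^ (j + 3) - k)).
  rewrite expnD => le_k.
  have j_gt0 : 0 < 2 ^ j by rewrite expn_gt0.
  have SE : (2 ^ j * 8 - 1).+1 = 2 ^ j * 2 ^ 3 by lia.
  have c7 : letter_change (k * (2 ^ j * 8 - 1)).
    have ->: 2 ^ j * 8 - 1 = 8 * (2 ^ j).-1 + 7 by lia.
    by apply: letter_change_3mod8; rewrite -modnMm k5; lia.
  have c8 : letter_change (k * (2 ^ j * 8 - 1).+1).
    by apply: letter_change_even; rewrite SE; lia.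
  move: (no_square _ c7 c8); rewrite SE -expnD mulnC thue_morse_mulexp => ->.
  (* With J = j + 3, k (2^J - 1) = 2^J (k - 1) + (2^J - k). *)
  congr (~~ _); rewrite -(thue_morse_expD (j + 3)); last by rewrite expnD; lia.
  by congr thue_morse; rewrite expnD; nia.
have le_k : k <= 2 ^ (k + 3).
  apply: leq_trans (ltnW (ltn_expl k (isT : 1 < 2))) _.
  by rewrite leq_exp2l // leq_addr.
move: (key k le_k) (key k.+1); rewrite addSn expnS.
(* Raising J by one adds a leading binary digit 1 to the remainder, which flips its t. *)
have ->: 2 * 2 ^ (k + 3) - k = 2 ^ (k + 3) * 1 + (2 ^ (k + 3) - k) by lia.
rewrite thue_morse_expD; last by lia.
move=> -> /(_ _); have -> : k <= 2 * 2 ^ (k + 3) by lia.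
move=> /(_ isT).
by case: (thue_morse k.-1) (thue_morse (_ - _)) => [] [].
Qed.

Lemma no_square_absurd : False.
Proof.
have : ~~ letter_change k by rewrite /letter_change thue_morse_succ eqxx.
have [even_k|odd_k] := boolP (~~ odd k).
  by rewrite letter_change_even.
have [k3|] := eqVneq (k %% 8) 3; first by rewrite letter_change_3mod8.
(* Only the residues 1, 5 and 7 remain, excluded by the facts above. *)
lia.
Qed.

End NoSquare.

Lemma thue_morse_square k : 1 < k -> exists n,
  [/\ letter_change (k * n), letter_change (k * n.+1) &
      thue_morse (k * n.+1) = thue_morse (k * n)].
Proof.
move=> k_gt1.
apply: NNPP => no_n; apply: (no_square_absurd k k_gt1) => n c0 c1.
apply/eqP/negPn/negP => ne; apply: no_n; exists n; split=> //.
by move: ne; case: thue_morse (thue_morse _) => [] [].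
Qed.

Theorem mainTheorem1 (v : nat -> 'I_3) (hv0 : v 0 = l0)
  (hv : fixed_point h v) (k : nat) (hk : 2 <= k) :
  factor [:: l0; l0] (fun n => v (k * n)) \/
  factor [:: l2; l2] (fun n => v (k * n)).
Proof.
have vE : v =1 vtm by apply: fixed_point_h_unique => //; exact: fixed_point_vtm.
have [n [c0 c1 e]] := thue_morse_square k hk.
(* At a change of letter, t alone decides between 0 and 2. *)
have vE0 : vtm (k * n) = if thue_morse (k * n) then l2 else l0.
  by rewrite /vtm (negPf c0).
have vE1 : vtm (k * n.+1) = if thue_morse (k * n) then l2 else l0.
  by rewrite /vtm (negPf c1) e.
case: (thue_morse (k * n)) vE0 vE1 => vE0 vE1; [right|left]; exists n;
  by rewrite /mkseq /= addn0 addn1 !vE vE0 vE1.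
Qed.
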